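(* Let $p^\star,q$ be two probability densities on $\mathcal X$ with respect to $\mu$, let $n\ge1$, and let $X_1,\dots,X_n$ be i.i.d. with density $p^\star$. Consider Bayesian model averaging with a uniform prior, which outputs $$\widehat p=(1-\widehat\alpha)p^\star+\widehat\alpha\,q,\qquad \widehat\alpha=\frac{\prod_{i=1}^nq(X_i)}{\prod_{i=1}^np^\star(X_i)+\prod_{i=1}^nq(X_i)}.$$ Then for any $\delta\in(0,1/2)$, with probability at least $1-\delta$, $$\mathrm{KL}(p^\star,\widehat p)\le\min\left\{\frac{10\log^2(2/\delta)}{n},\ 5\log\left(\frac2\delta\right)\right\}.$$ Moreover, for any $\delta\in(0,e^{-2}]$, taking $\mathcal X=\{0,1\}$ (with the counting measure), letting $q$ be the point mass at $1$, and letting $p^\star$ be the Bernoulli law on $\{0,1\}$ with $(1-p^\star(0))^n=\delta$, the Bayesian model averaging estimator $\widehat p=(1-\widehat\alpha)p^\star+\widehat\alpha\,q$ with $\widehat\alpha=\frac{\prod_{i=1}^nq(X_i)}{\prod_{i=1}^np^\star(X_i)+\prod_{i=1}^nq(X_i)}$ satisfies, with probability at least $\delta$, $$\mathrm{KL}(p^\star,\widehat p)\ge\min\left\{\frac{\log^2(1/\delta)}{4n},\ \frac14\log\left(\frac1\delta\right)\right\}.$$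
   Context: For probability densities $p,q$ on $(\mathcal X,\mu)$, $\mathrm{KL}(p,q)=\int_{\mathcal X}p\log(p/q)\,d\mu\in[0,+\infty]$. $\log$ is the natural logarithm, and $\log^2(x)=(\log x)^2$. *)

(* Defs.v *)
From mathcomp Require Export all_boot all_order all_algebra.
From mathcomp Require Export all_classical all_reals all_analysis.

Set Implicit Arguments.
Unset Strict Implicit.
Unset Printing Implicit Defensive.

Import Order.TTheory GRing.Theory Num.Theory.
Import numFieldNormedType.Exports.

Local Open Scope classical_set_scope.
Local Open Scope ring_scope.

Definition is_density d (X : measurableType d) (R : realType)
    (mu : {measure set X -> \bar R}) (p : X -> R) : Prop :=
  [/\ measurable_fun setT p, forall x, 0 <= p x &
      (\int[mu]_x (p x)%:E = 1)%E].

(* The extended operations carry the usual conventions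
   0 log(0 / q) = 0 and p log(p / 0) = +oo for p > 0, because on [\bar R]
   0^-1 = +oo, lne 0 = -oo, lne +oo = +oo and 0 * (-oo) = 0 * +oo = 0.
   The negative part of the integrand has integral at most that of q, so for
   densities the difference defining the integral is never +oo - +oo. *)
Definition KL d (X : measurableType d) (R : realType)
    (mu : {measure set X -> \bar R}) (p q : X -> R) : \bar R :=
  (\int[mu]_x ((p x)%:E * lne ((p x)%:E / (q x)%:E)))%E.

Definition mutually_independent d d' (Omega : measurableType d)
    (X : measurableType d') (R : realType) (P : probability Omega R)
    (n : nat) (Xs : 'I_n -> {RV P >-> X}) : Prop :=
  forall (J : {set 'I_n}) (A : 'I_n -> set X),
    (forall i, measurable (A i)) ->
    P [set w | forall i, i \in J -> A i (Xs i w)] =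
      (\prod_(i in J) P (Xs i @^-1` A i))%E.

Definition has_density d d' (Omega : measurableType d) (X : measurableType d')
    (R : realType) (P : probability Omega R)
    (mu : {measure set X -> \bar R}) (p : X -> R) (Y : {RV P >-> X}) : Prop :=
  forall A : set X, measurable A ->
    (distribution P Y A = \int[mu]_(x in A) (p x)%:E)%E.

Definition iid_with_density d d' (Omega : measurableType d)
    (X : measurableType d') (R : realType) (P : probability Omega R)
    (mu : {measure set X -> \bar R}) (p : X -> R)
    (n : nat) (Xs : 'I_n -> {RV P >-> X}) : Prop :=
  mutually_independent Xs /\ forall i, has_density mu p (Xs i).

(* When the denominator vanishes (a null event for samples drawn from p) the
   value is 0, since x / 0 = 0. *)
Definition bma_weight (X : Type) (R : realType) (p q : X -> R)
    (n : nat) (x : 'I_n -> X) : R :=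
  (\prod_(i < n) q (x i)) / (\prod_(i < n) p (x i) + \prod_(i < n) q (x i)).

Definition bma (X : Type) (R : realType) (p q : X -> R)
    (n : nat) (x : 'I_n -> X) : X -> R :=
  fun y => (1 - bma_weight p q x) * p y + bma_weight p q x * q y.

(* Main.v *)
(** Put W = prod q(X_i) / prod p(X_i), so that the weight is a = W / (1 + W) and
    p^ >= p / (1 + W); hence KL(p, p^) <= log (1 + W).  Comparing KL with the squared
    Hellinger distance under this density ratio bound, and using its convexity, gives
    KL(p, p^) <= (3 + log (1 + W)) a D with D = int (sqrt p - sqrt q)^2.  Since
    E (sqrt W) = (1 - D / 2)^n <= exp (- n D / 2), Markov's inequality yields
    W <= exp (- n D) / delta^2 with probability at least 1 - delta, and then
    n a D <= 2 log (1 / delta) whatever D is.  For the lower bound, on the event that all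
    X_i equal 1, of probability delta, the term of the divergence at 0 alone is large enough. *)

Require Import Defs.
From mathcomp Require Import all_boot all_order all_algebra.
From mathcomp Require Import all_classical all_reals all_analysis.
From mathcomp Require Import measurable_realfun ring lra.

Set Implicit Arguments.
Unset Strict Implicit.
Unset Printing Implicit Defensive.

Import Order.TTheory GRing.Theory Num.Theory.
Import numFieldNormedType.Exports.

Local Open Scope classical_set_scope.
Local Open Scope ring_scope.

(** * Scalar inequalities behind the divergence bounds *)

Section real_inequalities.
Context {R : realType}.
Implicit Types (x z p q r s v a b l M : R).

Lemma ln_leB1 x : 0 < x -> ln x <= x - 1.
Proof.
by move=> x0; rewrite -{1}(subrK 1 x) addrC le_ln1Dx// ltrBrDl subrr.
Qed.

Lemma mul_ln_div_ge p r : 0 < p -> 0 < r -> p - r <= p * ln (p / r).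
Proof.
move=> p0 r0; rewrite -(invf_div r p) lnV ?posrE ?divr_gt0//.
have /(ler_wpM2l (ltW p0)) : ln (r / p) <= r / p - 1 by rewrite ln_leB1 ?divr_gt0.
by rewrite mulrBr mulr1 mulrCA divff ?gt_eqF// mulr1 mulrN; lra.
Qed.

(** By [ln x <= x - 1] the increment is at least [(r b - r a) * (1 - p / r a)]. This is nonnegative,
    since [r b - r a] and [r a - p] are the nonnegative multiples [b - a] and [a] of the same number
    [q - p]. *)
Lemma kl_gap_mixture_le p q a b : 0 < p -> 0 <= q -> 0 <= a <= b -> b <= 1 ->
  let r := fun c => (1 - c) * p + c * q in
  0 < r a -> 0 < r b ->
  p * ln (p / r a) + (r a - p) <= p * ln (p / r b) + (r b - p).
Proof.
move=> p0 q0 /andP[a0 ab] b1 r ra0 rb0.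
rewrite !ln_div ?posrE//.
have H : ln (r b) - ln (r a) <= r b / r a - 1.
  by rewrite -ln_div ?posrE// ln_leB1 ?divr_gt0.
have {}H : p * (ln (r b) - ln (r a)) <= (r b - r a) * (p / r a).
  rewrite (le_trans (ler_wpM2l (ltW p0) H))// le_eqVlt; apply/orP; left.
  by apply/eqP; field; rewrite gt_eqF.
suff : (r b - r a) * (p / r a) <= r b - r a by lra.
rewrite mulrA ler_pdivrMr// -subr_ge0.
have -> : (r b - r a) * r a - (r b - r a) * p = a * (b - a) * (q - p) ^+ 2.
  by rewrite /r; ring.
by rewrite mulr_ge0 ?sqr_ge0// mulr_ge0// subr_ge0.
Qed.

(* The bound [ln (s / v) <= s / v - 1] suffices both for [v <= s] and for [s <= v]; the
   constant 3 is exactly what it requires when [v < s]. *)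
Lemma kl_gap_le_hellinger s v l : 0 < s -> 0 < v -> 0 <= l -> ln (s ^+ 2 / v ^+ 2) <= l ->
  s ^+ 2 * ln (s ^+ 2 / v ^+ 2) + (v ^+ 2 - s ^+ 2) <= (3 + l) * (s - v) ^+ 2.
Proof.
move=> s0 v0 l0; set a := ln (s / v).
have sv0 : 0 < s / v by rewrite divr_gt0.
have -> : ln (s ^+ 2 / v ^+ 2) = 2 * a.
  by rewrite -expr_div_n lnXn// mulr2n mulrDl mul1r.
move=> al.
have va : v * a <= s - v.
  rewrite (le_trans (ler_wpM2l (ltW v0) (ln_leB1 sv0)))// le_eqVlt; apply/orP; left.
  by apply/eqP; field; rewrite gt_eqF.
have [sv|vs] := leP s v.
  apply: (@le_trans _ _ (3 * (s - v) ^+ 2)); last first.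
    by rewrite ler_wpM2r ?sqr_ge0// lerDl.
  have H : s * (v * a) <= s * (s - v) by rewrite ler_pM2l.
  rewrite -(ler_pM2l v0).
  have -> : v * (s ^+ 2 * (2 * a) + (v ^+ 2 - s ^+ 2)) =
    2 * s * (s * (v * a)) + v * (v ^+ 2 - s ^+ 2) by ring.
  apply: (@le_trans _ _ (2 * s * (s * (s - v)) + v * (v ^+ 2 - s ^+ 2))).
    by rewrite lerD2r ler_pM2l// mulr_gt0.
  rewrite -subr_ge0.
  have -> : v * (3 * (s - v) ^+ 2) - (2 * s * (s * (s - v)) + v * (v ^+ 2 - s ^+ 2)) =
    2 * (v - s) ^+ 3 by ring.
  by rewrite mulr_ge0// exprn_ge0// subr_ge0.
apply: (@le_trans _ _ ((3 + 2 * a) * (s - v) ^+ 2)); last first.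
  by rewrite ler_wpM2r ?sqr_ge0// lerD2l.
rewrite -subr_ge0.
have -> : (3 + 2 * a) * (s - v) ^+ 2 - (s ^+ 2 * (2 * a) + (v ^+ 2 - s ^+ 2)) =
  2 * (2 * s - v) * (s - v - v * a) by ring.
by rewrite !mulr_ge0//; lra.
Qed.

(** Concavity of the square root makes [p + r - 2 * sqrt p * sqrt r] convex in [r], and it vanishes
    at [r = p]. *)
Lemma sqrt_mixture_le p q a : 0 <= p -> 0 <= q -> 0 <= a <= 1 ->
  (Num.sqrt p - Num.sqrt ((1 - a) * p + a * q)) ^+ 2 <=
  a * (Num.sqrt p - Num.sqrt q) ^+ 2.
Proof.
move=> p0 q0 /andP[a0 a1].
have r0 : 0 <= (1 - a) * p + a * q by rewrite addr_ge0// mulr_ge0// subr_ge0.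
have := sqr_sqrtr p0; have := sqr_sqrtr q0; have := sqr_sqrtr r0.
set s := Num.sqrt p; set t := Num.sqrt q; set v := Num.sqrt _ => vE tE sE.
have s0 : 0 <= s by exact: sqrtr_ge0.
have t0 : 0 <= t by exact: sqrtr_ge0.
have v0 : 0 <= v by exact: sqrtr_ge0.
have H : (1 - a) * s + a * t <= v.
  rewrite -(@ler_pXn2r _ 2)// ?nnegrE ?addr_ge0 ?mulr_ge0 ?subr_ge0//.
  rewrite vE -tE -sE -subr_ge0.
  have -> : (1 - a) * s ^+ 2 + a * t ^+ 2 - ((1 - a) * s + a * t) ^+ 2 =
    a * (1 - a) * (s - t) ^+ 2 by ring.
  by rewrite mulr_ge0 ?sqr_ge0// mulr_ge0// subr_ge0.
have {}H : s * ((1 - a) * s + a * t) <= s * v by rewrite ler_wpM2l.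
rewrite sqrrB vE -tE -sE -subr_ge0.
suff : 0 <= s * v - s * ((1 - a) * s + a * t) by lra.
by rewrite subr_ge0.
Qed.

(** The map [z * expR (M - z)] decreases past [z = 1] and equals [M] at [z = M]. It serves with
    [z = n D] and [M = 2 log (1 / delta)]. *)
Lemma mul_expRB_le M z : 1 <= M -> M <= z -> z * expR (M - z) <= M.
Proof.
move=> M1 Mz; rewrite -opprB expRN ler_pdivrMr ?expR_gt0//.
have := expR_ge1Dx (z - M).
have : 0 <= (M - 1) * (z - M) by rewrite mulr_ge0 ?subr_ge0.
nra.
Qed.

(** Follows from [expR (- x) <= 1 / (1 + x)]. In the lower bound it controls the mass at 0, which is
    [1 - expR (- x)] with [x = log (1 / delta) / n]. *)
Lemma half_min_le_oneBexpRN x : 0 <= x -> Num.min x 1 / 2 <= 1 - expR (- x).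
Proof.
move=> x0; have e0 := expR_gt0 x.
have e1 := expR_ge1Dx x.
have : expR (- x) <= (1 + x)^-1 by rewrite expRN lef_pV2 ?posrE//; lra.
have [x1|x1] := leP x 1.
  suff : (1 + x)^-1 <= 1 - x / 2 by lra.
  by rewrite invf_ple ?posrE; [|lra..]; rewrite -[leLHS]mul1r ler_pdivrMr; nra.
suff : (1 + x)^-1 <= 1 / 2 by lra.
by rewrite div1r lef_pV2 ?posrE//; lra.
Qed.

End real_inequalities.

(* The integrand of [KL] made pointwise nonnegative; the added term [r - p] has
   integral 0 when p and r are densities. *)
Definition kl_gap {R : realType} (p r : R) : \bar R :=
  (p%:E * lne (p%:E / r%:E) + (r - p)%:E)%E.

(** * Pointwise bounds on the nonnegative divergence integrand *)

Section kl_gap.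
Context {R : realType}.
Implicit Types (p q r a b l : R).

Lemma kl_gap0r r : kl_gap 0 r = r%:E.
Proof. by rewrite /kl_gap mul0e subr0 add0e. Qed.

Lemma kl_gapr0 p : 0 < p -> kl_gap p 0 = +oo%E.
Proof.
move=> p0.
by rewrite /kl_gap /inve eqxx gt0_muley ?lte_fin// /= gt0_muley ?lte_fin.
Qed.

Lemma kl_gapE p r : 0 < p -> 0 < r -> kl_gap p r = (p * ln (p / r) + (r - p))%:E.
Proof.
move=> p0 r0.
by rewrite /kl_gap /inve gt_eqF// -EFinM lne_EFin ?divr_gt0// -EFinM -EFinD.
Qed.

(** A nested conditional whose branches are each measurable, with the logarithm confined to a
    real-valued branch. *)
Lemma kl_gap_case p r : 0 <= p -> 0 <= r -> kl_gap p r =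
  if p == 0 then r%:E else if r == 0 then +oo%E else (p * ln (p / r) + (r - p))%:E.
Proof.
rewrite !le_eqVlt => /predU1P[<- _|p0 /predU1P[<-|r0]].
- by rewrite eqxx kl_gap0r.
- by rewrite eqxx gt_eqF// kl_gapr0.
- by rewrite !gt_eqF// kl_gapE.
Qed.

Lemma kl_gap_ge0 p r : 0 <= p -> 0 <= r -> (0 <= kl_gap p r)%E.
Proof.
move=> + r0; rewrite le_eqVlt => /predU1P[<-|p0]; first by rewrite kl_gap0r lee_fin.
move: r0; rewrite le_eqVlt => /predU1P[<-|r0].
  by rewrite kl_gapr0.
by rewrite kl_gapE// lee_fin; have := mul_ln_div_ge p0 r0; lra.
Qed.

Lemma mixture_ge0 p q a : 0 <= p -> 0 <= q -> 0 <= a <= 1 -> 0 <= (1 - a) * p + a * q.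
Proof. by move=> p0 q0 /andP[a0 a1]; rewrite addr_ge0 ?mulr_ge0// subr_ge0. Qed.

(** Adds the degenerate cases to the scalar monotonicity: for [p = 0] the gap is linear in the
    weight, and for [p > 0] a vanishing mixture at [b] makes the right side infinite. *)
Lemma le_kl_gap_mixture p q a b : 0 <= p -> 0 <= q -> 0 <= a <= b -> b <= 1 ->
  (kl_gap p ((1 - a) * p + a * q)%R <= kl_gap p ((1 - b) * p + b * q)%R)%E.
Proof.
move=> + q0 /[dup] ab0 /andP[a0 ab] b1.
rewrite le_eqVlt => /predU1P[<-|p0].
  by rewrite !kl_gap0r lee_fin !mulr0 !add0r ler_wpM2r.
have [rb|rb] := eqVneq ((1 - b) * p + b * q) 0; first by rewrite rb kl_gapr0// leey.
have rb0 : 0 < (1 - b) * p + b * q.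
  by rewrite lt0r rb mixture_ge0// ?(ltW p0)// (le_trans a0 ab).
have ra0 : 0 < (1 - a) * p + a * q.
  (* If [a >= 1] then [a = b], and positivity is inherited from the mixture at [b]. *)
  have [a1|a1] := ltP a 1.
    by rewrite ltr_pwDl ?mulr_ge0// mulr_gt0// subr_gt0.
  by have -> : a = b by apply/eqP; rewrite eq_le ab (le_trans b1).
by rewrite !kl_gapE// lee_fin kl_gap_mixture_le.
Qed.

(** For [p > 0] the last hypothesis says [ln (p / r) <= l]. Terms are placed so that both sides are
    sums of nonnegative functions and can be integrated termwise. *)
Lemma kl_gap_le_ln p r l : 0 <= p -> 0 <= r -> expR (- l) * p <= r ->
  (kl_gap p r + p%:E <= l%:E * p%:E + r%:E)%E.
Proof.
rewrite le_eqVlt => /predU1P[<- r0 _|p0 _ pr].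
  by rewrite kl_gap0r mule0 adde0 add0e.
have r0 : 0 < r by rewrite (lt_le_trans _ pr)// mulr_gt0 ?expR_gt0.
rewrite kl_gapE// -EFinM -!EFinD lee_fin.
have : p * ln (p / r) <= l * p.
  rewrite mulrC ler_pM2r// -(ler_expR) lnK ?posrE ?divr_gt0//.
  by rewrite ler_pdivrMr// mulrC -ler_pdivrMr ?expR_gt0// -expRN mulrC.
lra.
Qed.

(** The mixture is at least [(1 - a) * p], so [l] bounds the log ratio; the Hellinger comparison at
    the square roots of [p] and the mixture is then combined with convexity, which extracts the
    factor [a]. *)
Lemma kl_gap_mixture_le_hellinger p q a l : 0 <= p -> 0 <= q -> 0 <= a < 1 ->
  0 <= l -> expR (- l) <= 1 - a ->
  (kl_gap p ((1 - a) * p + a * q)%R <=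
   ((3 + l) * a * (Num.sqrt p - Num.sqrt q) ^+ 2)%:E)%E.
Proof.
move=> + q0 /andP[a0 a1] l0 la.
rewrite le_eqVlt => /predU1P[<-|p0].
  rewrite kl_gap0r lee_fin mulr0 add0r sqrtr0 sub0r sqrrN sqr_sqrtr// -mulrA.
  by rewrite ler_peMl ?mulr_ge0//; lra.
set r := (1 - a) * p + a * q.
have r0 : 0 < r by rewrite ltr_pwDl ?mulr_ge0// mulr_gt0// subr_gt0.
rewrite kl_gapE// lee_fin.
have := @kl_gap_le_hellinger _ (Num.sqrt p) (Num.sqrt r) l.
rewrite !sqrtr_gt0 !sqr_sqrtr ?(ltW p0) ?(ltW r0)// => /(_ p0 r0 l0) H.
apply: (le_trans (H _)).
  rewrite -ler_expR lnK ?posrE ?divr_gt0//.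
  rewrite ler_pdivrMr// mulrC -ler_pdivrMr ?expR_gt0// -expRN mulrC.
  by rewrite (le_trans (ler_wpM2r (ltW p0) la))// /r lerDl mulr_ge0.
rewrite -mulrA ler_wpM2l//; first lra.
by rewrite sqrt_mixture_le ?(ltW p0)// a0 ltW.
Qed.

End kl_gap.

(** * Measurability of quotients, square roots and the integrand *)

Section measurability.
Context d (X : measurableType d) (R : realType).
Implicit Types p r : X -> R.

Lemma measurable_fun_div (D : set X) p r : measurable D ->
  measurable_fun D p -> measurable_fun D r ->
  (forall x, D x -> 0 <= r x) -> measurable_fun D (fun x => p x / r x).
Proof.
move=> mD mp mr r0; apply: measurable_funM => //.
(* On nonnegative reals the inverse is the power -1, also at 0 where both are 0. *)
apply: (eq_measurable_fun (fun x => r x `^ (-1))).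
  by move=> x /[!inE] Dx; rewrite powR_inv1// r0.
exact: (measurableT_comp (measurable_powR _)).
Qed.

Lemma measurable_kl_gap p r : measurable_fun setT p -> measurable_fun setT r ->
  (forall x, 0 <= p x) -> (forall x, 0 <= r x) ->
  measurable_fun setT (fun x => kl_gap (p x) (r x)).
Proof.
move=> mp mr p0 r0; under eq_fun do rewrite kl_gap_case//.
apply: measurable_fun_ifT; first exact: measurable_fun_eqr.
  exact/measurable_EFinP.
apply: measurable_fun_ifT => //; first exact: measurable_fun_eqr.
apply/measurable_EFinP; apply: measurable_funD; last exact: measurable_funB.
apply: measurable_funM => //; apply: measurableT_comp; first exact: measurable_ln.
exact: measurable_fun_div.
Qed.

Lemma measurable_sqrt p : measurable_fun setT p ->
  measurable_fun setT (fun x => Num.sqrt (p x)).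
Proof.
move=> mp; apply: (measurableT_comp _ mp); apply: continuous_measurable_fun.
exact: sqrt_continuous.
Qed.

End measurability.

(** * Divergence from a density to a mixture, and the Hellinger affinity *)

Section densities.
Context d (X : measurableType d) (R : realType) (mu : {measure set X -> \bar R}).
Implicit Types (p q r : X -> R) (a b l : R).

(** The signed integrand [f] is the gap plus [p - r], so [f^+ + r = f^- + gap + p] between
    nonnegative functions. After integration the masses 1 cancel, and so does the integral of [f^-],
    which is finite because [f^- <= r]. *)
Lemma KL_gapE p r : is_density mu p -> is_density mu r ->
  KL mu p r = (\int[mu]_x kl_gap (p x) (r x))%E.
Proof.
move=> [mp p0 p1] [mr r0 r1]; rewrite /KL.
set f := fun x => _; set h := fun x => kl_gap _ _.
have mh : measurable_fun setT h by exact: measurable_kl_gap.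
have h0 x : (0 <= h x)%E by exact: kl_gap_ge0.
have fE : f = (fun x => h x + (p x - r x)%:E)%E.
  apply/funext => x; rewrite /h /kl_gap -addeA -EFinD.
  by rewrite (_ : r x - p x + (p x - r x) = 0) ?adde0//; ring.
have mf : measurable_fun setT f.
  rewrite fE; apply: emeasurable_funD => //.
  by apply/measurable_EFinP; exact: measurable_funB.
have fpn x : (f^\+ x + (r x)%:E = f^\- x + h x + (p x)%:E)%E.
  rewrite funeposE funenegE fE; move: (h0 x); case: (h x) => [t| |//] /=; last first.
    by rewrite maxye maxNye.
  rewrite lee_fin => t0; rewrite -EFinD -!EFin_max -!EFinD; congr EFin.
  by rewrite /Num.max; case: ltP => ?; case: ltP => ?; lra.
have fn1 x : (f^\- x <= (r x)%:E)%E.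
  rewrite funenegE fE; move: (h0 x) (p0 x) (r0 x); case: (h x) => [t| |//] /=; last first.
    by move=> _ _ rx; rewrite maxNye lee_fin.
  rewrite lee_fin => t0 px rx; rewrite -EFin_max lee_fin.
  by rewrite ge_max rx andbT; lra.
have mr' : measurable_fun setT (EFin \o r) by exact/measurable_EFinP.
have mp' : measurable_fun setT (EFin \o p) by exact/measurable_EFinP.
have mfp := measurable_funepos mf; have mfn := measurable_funeneg mf.
have Ipos : (\int[mu]_x (f^\+ x + (r x)%:E) = \int[mu]_x f^\+ x + 1)%E.
  by rewrite ge0_integralD ?r1// => x _; rewrite lee_fin.
have Ineg : (\int[mu]_x (f^\- x + h x + (p x)%:E) =
    \int[mu]_x f^\- x + \int[mu]_x h x + 1)%E.
  rewrite ge0_integralD ?p1//; first by rewrite ge0_integralD.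
  - by move=> x _; rewrite adde_ge0.
  - exact: emeasurable_funD.
  - by move=> x _; rewrite lee_fin.
have H : (\int[mu]_x f^\+ x + 1 = \int[mu]_x f^\- x + \int[mu]_x h x + 1)%E.
  by rewrite -Ipos -Ineg; exact: eq_integral.
have fn_fin : (\int[mu]_x f^\- x \is a fin_num)%E.
  rewrite ge0_fin_numE ?integral_ge0//.
  apply: (@le_lt_trans _ _ 1%E); last exact: ltry.
  rewrite -r1; apply: ge0_le_integral => //.
rewrite integralE.
by rewrite -[X in (X - _)%E](@addeK _ 1%E)// H addeK// addeC addeA -addeA addeK.
Qed.

Lemma is_density_mixture p q a : is_density mu p -> is_density mu q -> 0 <= a <= 1 ->
  is_density mu (fun x => (1 - a) * p x + a * q x).
Proof.
move=> [mp p0 p1] [mq q0 q1] /[dup] a01 /andP[a0 a1].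
have a1' : 0 <= 1 - a by rewrite subr_ge0.
split => [|x|]; [by apply: measurable_funD; exact: measurable_funM| |].
  exact: mixture_ge0.
under eq_integral do rewrite EFinD !EFinM.
have mp' : measurable_fun setT (EFin \o p) by exact/measurable_EFinP.
have mq' : measurable_fun setT (EFin \o q) by exact/measurable_EFinP.
rewrite ge0_integralD//; first last.
- exact: measurable_funeM.
- by move=> x _; rewrite mule_ge0 ?lee_fin.
- exact: measurable_funeM.
- by move=> x _; rewrite mule_ge0 ?lee_fin.
rewrite !ge0_integralZl_EFin//; try by move=> x _; rewrite lee_fin.
by rewrite p1 q1 !mule1 -EFinD subrK.
Qed.

Section mixture.
Variables (p q : X -> R).
Hypotheses (dp : is_density mu p) (dq : is_density mu q).

Let mp : measurable_fun setT p. Proof. by case: dp. Qed.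
Let mq : measurable_fun setT q. Proof. by case: dq. Qed.
Let p0 x : 0 <= p x. Proof. by case: dp. Qed.
Let q0 x : 0 <= q x. Proof. by case: dq. Qed.
Let p1 : (\int[mu]_x (p x)%:E = 1)%E. Proof. by case: dp. Qed.
Let q1 : (\int[mu]_x (q x)%:E = 1)%E. Proof. by case: dq. Qed.

Let mix a : X -> R := fun x => (1 - a) * p x + a * q x.

Let mix_ge0 a x : 0 <= a <= 1 -> 0 <= mix a x.
Proof. exact: mixture_ge0. Qed.

Let mgap a : 0 <= a <= 1 -> measurable_fun setT (fun x => kl_gap (p x) (mix a x)).
Proof.
move=> a01; have [mm m0 _] := is_density_mixture dp dq a01.
exact: measurable_kl_gap.
Qed.

Lemma le_KL_mixture a b : 0 <= a <= b -> b <= 1 ->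
  (KL mu p (fun x => (1 - a) * p x + a * q x)%R <=
   KL mu p (fun x => (1 - b) * p x + b * q x)%R)%E.
Proof.
move=> /[dup] ab /andP[a0 leab] b1.
have b01 : 0 <= b <= 1 by rewrite b1 (le_trans a0).
have a01 : 0 <= a <= 1 by rewrite a0 (le_trans leab).
rewrite !KL_gapE//; [|exact: is_density_mixture..].
apply: ge0_le_integral => //; [|exact: mgap|exact: mgap|].
- by move=> x _; apply: kl_gap_ge0 => //; exact: mix_ge0.
- by move=> x _; exact: le_kl_gap_mixture.
Qed.

Lemma KL_mixture_le_ln a l : 0 <= a <= 1 -> expR (- l) <= 1 - a ->
  (KL mu p (fun x => (1 - a) * p x + a * q x)%R <= l%:E)%E.
Proof.
move=> /[dup] a01 /andP[a0 a1] la.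
have l0 : 0 <= l by rewrite -oppr_le0 -expR_le1 (le_trans la)// lerBlDr lerDl.
have dm := is_density_mixture dp dq a01; have [mm m0 m1] := dm.
rewrite KL_gapE//.
have mp' : measurable_fun setT (EFin \o p) by exact/measurable_EFinP.
have mm' : measurable_fun setT (EFin \o mix a) by exact/measurable_EFinP.
have gap0 x : (0 <= kl_gap (p x) (mix a x))%E by apply: kl_gap_ge0 => //; exact: mix_ge0.
have p0' x : (0 <= (p x)%:E)%E by rewrite lee_fin.
have m0' x : (0 <= (mix a x)%:E)%E by rewrite lee_fin mix_ge0.
have lp0 x : (0 <= l%:E * (p x)%:E)%E by rewrite mule_ge0.
have mlp : measurable_fun setT (fun x => l%:E * (p x)%:E)%E by exact: measurable_funeM.
have mg := mgap a01.
(* The added 1 is the mass of [p] on the left and that of the mixture on the right, matching the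
   subtraction-free pointwise bound. *)
suff : (\int[mu]_x kl_gap (p x) (mix a x) + 1 <= l%:E + 1)%E by rewrite leeD2rE.
rewrite -{1}p1 -m1 -[X in (_ <= X + _)%E]mule1 -p1.
rewrite -ge0_integralZl_EFin// -!ge0_integralD//; last by move=> x _; exact: m0'.
apply: ge0_le_integral => //.
- by move=> x _; rewrite adde_ge0.
- exact: emeasurable_funD.
- exact: emeasurable_funD.
- move=> x _; apply: kl_gap_le_ln => //; first exact: mix_ge0.
  by rewrite (le_trans (ler_wpM2r (p0 x) la))// lerDl mulr_ge0.
Qed.

Lemma KL_mixture_le_hellinger a l D : 0 <= a < 1 -> expR (- l) <= 1 - a ->
  (\int[mu]_x ((Num.sqrt (p x) - Num.sqrt (q x)) ^+ 2)%:E = D%:E)%E ->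
  (KL mu p (fun x => (1 - a) * p x + a * q x)%R <= ((3 + l) * a * D)%:E)%E.
Proof.
move=> /[dup] a01' /andP[a0 a1] la DE.
have l0 : 0 <= l by rewrite -oppr_le0 -expR_le1 (le_trans la)// lerBlDr lerDl.
have a01 : 0 <= a <= 1 by rewrite a0 ltW.
rewrite KL_gapE//; last exact: is_density_mixture.
have mh : measurable_fun setT (fun x => ((Num.sqrt (p x) - Num.sqrt (q x)) ^+ 2)%:E).
  apply/measurable_EFinP; apply: measurable_funX.
  by apply: measurable_funB; exact: measurable_sqrt.
rewrite EFinM -DE -ge0_integralZl_EFin//; first last.
- by rewrite mulr_ge0// addr_ge0.
- by move=> x _; rewrite lee_fin sqr_ge0.
apply: ge0_le_integral => //.
- by move=> x _; apply: kl_gap_ge0 => //; exact: mix_ge0.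
- exact: mgap.
- exact: measurable_funeM.
- by move=> x _; exact: kl_gap_mixture_le_hellinger.
Qed.

(** Expanding the square, the first integrand plus twice the second is [p + q], of integral 2. Both
    integrals are nonnegative, hence finite, and [D] lies between 0 and 2. *)
Lemma hellinger_affinity : exists D : R,
  [/\ 0 <= D <= 2,
      (\int[mu]_x ((Num.sqrt (p x) - Num.sqrt (q x)) ^+ 2)%:E = D%:E)%E &
      (\int[mu]_x (Num.sqrt (p x) * Num.sqrt (q x))%:E = (1 - D / 2)%:E)%E].
Proof.
have ms := measurable_sqrt mp; have mt := measurable_sqrt mq.
set H := (\int[mu]_x _)%E; set B := (\int[mu]_x (_ * _)%:E)%E.
have H0 : (0 <= H)%E by apply: integral_ge0 => x _; rewrite lee_fin sqr_ge0.
have B0 : (0 <= B)%E by apply: integral_ge0 => x _; rewrite lee_fin mulr_ge0.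
have HB : (H + 2%:E * B = 2%:E)%E.
  have mh : measurable_fun setT (fun x => ((Num.sqrt (p x) - Num.sqrt (q x)) ^+ 2)%:E).
    by apply/measurable_EFinP; apply: measurable_funX; exact: measurable_funB.
  have mb : measurable_fun setT (fun x => (Num.sqrt (p x) * Num.sqrt (q x))%:E).
    by apply/measurable_EFinP; exact: measurable_funM.
  have h0 x : (0 <= ((Num.sqrt (p x) - Num.sqrt (q x)) ^+ 2)%:E)%E.
    by rewrite lee_fin sqr_ge0.
  have b0 x : (0 <= (Num.sqrt (p x) * Num.sqrt (q x))%:E)%E by rewrite lee_fin mulr_ge0.
  have b0' x : (0 <= 2%:E * (Num.sqrt (p x) * Num.sqrt (q x))%:E)%E by rewrite mule_ge0.
  have mb' : measurable_fun setT (fun x => 2%:E * (Num.sqrt (p x) * Num.sqrt (q x))%:E)%E.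
    exact: measurable_funeM.
  rewrite /B -ge0_integralZl_EFin// /H -ge0_integralD//.
  transitivity (\int[mu]_x ((p x)%:E + (q x)%:E))%E; last first.
    by rewrite ge0_integralD ?p1 ?q1//; try exact/measurable_EFinP;
      move=> x _; rewrite lee_fin.
  apply: eq_integral => x _ /=; rewrite -EFinM -!EFinD; congr EFin.
  by rewrite -[in RHS](sqr_sqrtr (p0 x)) -[in RHS](sqr_sqrtr (q0 x)); ring.
move: H0 B0 HB; case: H => [D| |]//; case: B => [b| |]//.
  rewrite !lee_fin -EFinM -EFinD => D0 b0 [Db].
  by exists D; split; [apply/andP; split; lra|by []|congr EFin; lra].
all: by rewrite gt0_muley ?lte_fin.
Qed.

End mixture.
End densities.

(** * Change of variables for an image of a weighted measure *)

Section weighted_change_of_variables.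
Local Open Scope ereal_scope.
Context d d' (T : measurableType d) (T' : measurableType d') (R : realType).
Variables (mu : {measure set T -> \bar R}) (nu : {measure set T' -> \bar R}).
Variables (g : T -> R) (Y : T -> T').
Hypotheses (mg : measurable_fun setT g) (g0 : forall x, (0 <= g x)%R).
Hypothesis mY : measurable_fun setT Y.
Hypothesis nuE : forall A, measurable A ->
  \int[mu]_(x in Y @^-1` A) (g x)%:E = nu A.

Import HBNNSimple.

(** [nuE] makes [nu] the image under [Y] of the measure with density [g], which is the claim for
    indicators. Linearity extends it to simple functions and monotone convergence to all nonnegative
    ones. *)
Lemma ge0_integral_weighted_comp (f : T' -> \bar R) :
  measurable_fun setT f -> (forall y, 0 <= f y) ->
  \int[mu]_x (f (Y x) * (g x)%:E) = \int[nu]_y f y.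
Proof.
move=> mf f0; pose h := nnsfun_approx measurableT mf.
have mgE : measurable_fun setT (EFin \o g) by exact/measurable_EFinP.
have mYA A : measurable A -> measurable (Y @^-1` A).
  by move=> mA; rewrite -[X in measurable X]setTI; exact: mY.
have hlim y : limn (fun n => (h n y)%:E) = f y.
  by apply/cvg_lim => //; exact: cvg_nnsfun_approx.
have -> : \int[nu]_y f y = limn (fun n => \int[nu]_y (h n y)%:E).
  rewrite -monotone_convergence//.
  - by apply: eq_integral => y _; rewrite hlim.
  - by move=> n; exact/measurable_EFinP.
  - by move=> n y _; rewrite lee_fin.
  - by move=> y _ a b ab; rewrite lee_fin; exact/lefP/nd_nnsfun_approx.
have -> : \int[mu]_x (f (Y x) * (g x)%:E) =
    limn (fun n => \int[mu]_x ((h n (Y x))%:E * (g x)%:E)).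
  rewrite -monotone_convergence//.
  - apply: eq_integral => x _; apply/esym/cvg_lim => //.
    by apply: cvgeZr => //; exact: cvg_nnsfun_approx.
  - move=> n; apply: emeasurable_funM => //.
    by apply/measurable_EFinP; exact: (measurableT_comp _ mY).
  - by move=> n y _; rewrite mule_ge0 ?lee_fin.
  - move=> y _ a b ab; rewrite lee_wpmul2r ?lee_fin//.
    exact/lefP/nd_nnsfun_approx.
congr (limn _); apply/funext => n.
have hE y : (h n y)%:E = \sum_(r \in range (h n)) (r * \1_(h n @^-1` [set r]) y)%:E.
  by rewrite fimfunE -fsumEFin.
under [RHS]eq_integral do rewrite hE.
rewrite ge0_integral_fsum//; last 2 first.
- by move=> r; exact/measurable_EFinP/measurable_funM.
- by move=> r y _; exact: nnfun_muleindic_ge0.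
under [LHS]eq_integral.
  move=> x _; rewrite hE ge0_mule_fsuml; last by move=> r; exact: nnfun_muleindic_ge0.
  over.
rewrite ge0_integral_fsum//; last 2 first.
- move=> r; apply: emeasurable_funM => //; apply/measurable_EFinP.
  by apply: measurable_funM => //; apply: (measurableT_comp _ mY).
- by move=> r x _; apply: mule_ge0; [exact: nnfun_muleindic_ge0|rewrite lee_fin].
apply: eq_fsbigr => r /[!inE] -[y _ hy].
have r0 : (0 <= r)%R by rewrite -hy.
have mr : measurable (h n @^-1` [set r]) by [].
under eq_integral do rewrite EFinM -muleA.
under [RHS]eq_integral do rewrite EFinM.
have mi : measurable_fun setT (fun x => (\1_(h n @^-1` [set r]) (Y x))%:E * (g x)%:E).
  apply: emeasurable_funM => //; apply/measurable_EFinP.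
  exact: (measurableT_comp _ mY).
have i0 x : 0 <= (\1_(h n @^-1` [set r]) (Y x))%:E * (g x)%:E.
  by rewrite mule_ge0 ?lee_fin.
have mi' : measurable_fun setT (fun y => (\1_(h n @^-1` [set r]) y)%:E : \bar R).
  exact/measurable_EFinP.
have i0' z : 0 <= (\1_(h n @^-1` [set r]) z)%:E :> \bar R by rewrite lee_fin.
rewrite !ge0_integralZl_EFin//.
congr (_ * _); rewrite integral_indic// setIT -nuE// [RHS]integral_mkcond.
apply: eq_integral => x _; rewrite patchE indicE /=.
case: ifPn => [|]; rewrite ?inE /= => xr.
- by rewrite mem_set ?mul1e.
- by rewrite memNset ?mul0e//; apply: contraNnot xr => ?; rewrite inE.
Qed.

End weighted_change_of_variables.

(** * Expectation of a product of independent factors *)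

Section independence.
Context d d' (Omega : measurableType d) (X : measurableType d') (R : realType).
Variables (P : probability Omega R) (n : nat) (Xs : 'I_n -> {RV P >-> X}).

Lemma integral_indic_comp (Y : {RV P >-> X}) (A : set X) : measurable A ->
  (\int[P]_w (\1_A (Y w))%:E = P (Y @^-1` A))%E.
Proof.
move=> mA; have mYA : measurable (Y @^-1` A) by exact: measurable_funPTI.
rewrite -[RHS](_ : P (Y @^-1` A `&` setT) = _)%E; last by rewrite setIT.
by rewrite -integral_indic.
Qed.

Hypothesis indep : mutually_independent Xs.

Lemma integral_prod_indic (A : 'I_n -> set X) : (forall i, measurable (A i)) ->
  (\int[P]_w (\prod_i \1_(A i) (Xs i w))%:E = \prod_i P (Xs i @^-1` A i))%E.
Proof.
move=> mA; have mB : measurable [set w | forall i, A i (Xs i w)].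
  rewrite [X in measurable X](_ : _ = \bigcap_(i in setT) (Xs i @^-1` A i)).
    by apply: fin_bigcap_measurable => // i _; exact: measurable_funPTI.
  by apply/seteqP; split => w /= H i; [move=> _|]; exact: H.
have := indep [set: 'I_n]%SET mA; rewrite (eq_bigl xpredT) => [<-|i]; last first.
  by rewrite finset.in_setT.
transitivity (\int[P]_w (\1_[set w | forall i, A i (Xs i w)] w)%:E)%E.
  apply: eq_integral => w _; congr EFin; rewrite indicE /=.
  have [H|H] := boolP (w \in _).
    rewrite big1// => i _; rewrite indicE mem_set//.
    by move: H; rewrite inE.
  have /existsNP[i Ai] : ~ forall i, A i (Xs i w).
    by apply: contraNnot H => H; rewrite inE.
  by apply/eqP; rewrite prodf_seq_eq0; apply/hasP; exists i;
    rewrite ?mem_index_enum//= indicE memNset.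
rewrite integral_indic// setIT; congr (P _).
by apply/seteqP; split => w /= H i; [move=> _|]; apply: H; rewrite ?finset.in_setT.
Qed.

(** Indicators are replaced by general functions one coordinate at a time. With the product [g] of
    the other factors as weight, the set function sending [A] to the integral of [g] over [X_j] in
    [A] is a multiple of the law of [X_j], and the weighted change of variables passes from [A] to
    [f j]. *)
Lemma integral_prod_indep (f : 'I_n -> X -> R) (c : 'I_n -> R) :
  (forall i, measurable_fun setT (f i)) -> (forall i x, 0 <= f i x) ->
  (forall i, (\int[P]_w (f i (Xs i w))%:E = (c i)%:E)%E) ->
  (\int[P]_w (\prod_i f i (Xs i w))%:E = (\prod_i c i)%:E)%E.
Proof.
(* [k] coordinates carry an arbitrary function, the others an indicator. *)
suff H k : forall (f : 'I_n -> X -> R) (c : 'I_n -> R),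
    (forall i, measurable_fun setT (f i)) -> (forall i x, 0 <= f i x) ->
    (forall i, (\int[P]_w (f i (Xs i w))%:E = (c i)%:E)%E) ->
    (forall i : 'I_n, (k <= i)%N -> exists2 A, measurable A & f i = \1_A) ->
    (\int[P]_w (\prod_i f i (Xs i w))%:E = (\prod_i c i)%:E)%E.
  by move=> mf f0 fc; apply: (H n) => // i; rewrite leqNgt ltn_ord.
elim: k => [|k IH] {}f {}c mf f0 fc fA.
  have {fA}/choice[A AE] : forall i, exists A, measurable A /\ f i = \1_A.
    by move=> i; have [A mA fiA] := fA i isT; exists A.
  under eq_integral do under eq_bigr do rewrite (AE _).2.
  rewrite integral_prod_indic; last by move=> i; exact: (AE i).1.
  rewrite -prodEFin; apply: eq_bigr => i _.
  by rewrite -fc (AE i).2 integral_indic_comp//; exact: (AE i).1.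
have [nk|kn] := leqP n k.
  by apply: IH => // i ki; have := ltn_ord i; rewrite ltnNge (leq_trans nk ki).
pose j := Ordinal kn.
have c0 i : 0 <= c i by rewrite -lee_fin -fc; apply: integral_ge0 => w _; rewrite lee_fin.
pose g w := \prod_(i < n | i != j) f i (Xs i w).
pose C := \prod_(i < n | i != j) c i.
have C0 : 0 <= C by exact: prodr_ge0.
have mg : measurable_fun setT g.
  rewrite /g; under eq_fun do rewrite big_mkcond.
  apply: measurable_prod => i _; case: (i != j) => //.
  exact: (measurableT_comp (mf i)).
have g0 w : 0 <= g w by rewrite prodr_ge0.
have mfj : measurable_fun setT (EFin \o f j) by exact/measurable_EFinP.
transitivity (\int[P]_w ((f j (Xs j w))%:E * (g w)%:E))%E.
  by apply: eq_integral => w _; rewrite -EFinM; congr EFin; rewrite (bigD1 j).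
rewrite (@ge0_integral_weighted_comp _ _ _ _ _ P (mscale (NngNum C0) (distribution P (Xs j)))
  g (Xs j) mg g0 _ _ (EFin \o f j))//; first last.
- by move=> y; rewrite lee_fin.
(* This is the induction hypothesis with the factor at [j] replaced by the indicator of [A]; the
   remaining coordinates from [k] on are strictly above [k]. *)
- move=> A mA; have mjA : measurable (Xs j @^-1` A) by exact: measurable_funPTI.
  rewrite integral_mkcond /mscale/=.
  pose f' i := if i == j then \1_A else f i.
  pose c' i := if i == j then fine (P (Xs j @^-1` A)) else c i.
  transitivity (\int[P]_w (\prod_i f' i (Xs i w))%:E)%E.
    apply: eq_integral => w _; rewrite (bigD1 j)//= /f' eqxx patchE indicE.
    rewrite (_ : \prod_(i < n | i != j) _ = g w); last first.
      by apply: eq_bigr => i /negbTE ->.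
    case: ifPn => [|]; rewrite ?inE /= => wA; first by rewrite mem_set// mul1r.
    by rewrite memNset ?mul0r//; apply: contraNnot wA => ?; rewrite inE.
  rewrite (IH f' c').
  + rewrite (bigD1 j)//= /c' eqxx EFinM fineK ?fin_num_measure// muleC.
    by congr (_%:E * _)%E; apply: eq_bigr => i /negbTE ->.
  + by move=> i; rewrite /f'; case: ifP.
  + by move=> i x; rewrite /f'; case: ifP.
  + move=> i; rewrite /f' /c'; case: ifP => [/eqP ->|//].
    by rewrite integral_indic_comp// fineK// fin_num_measure.
  + move=> i ki; rewrite /f'; case: ifP => [_|/negbT ij]; first by exists A.
    apply: fA; rewrite ltn_neqAle ki andbT; apply: contra ij => /eqP kE.
    by apply/eqP/val_inj.
rewrite ge0_integral_mscale//; last by move=> y _; rewrite lee_fin.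
rewrite ge0_integral_distribution//; last by move=> y; rewrite lee_fin.
by rewrite fc -EFinM/= mulrC (bigD1 j).
Qed.

End independence.

(** * Numerical form of the risk bounds *)

Section numeric_bounds.
Context {R : realType}.
Implicit Types (D W delta : R) (n : nat).

(** Squares [expR (1 / 2) <= 2], that is [expR (- (1 / 2)) >= 1 / 2]. The value 4 suffices because
    [2 / delta] and [1 / delta ^ 2] both exceed it. *)
Lemma expR1_le4 : expR 1 <= 4 :> R.
Proof.
have h : expR (1 / 2) <= 2 :> R.
  have := expR_ge1Dx (- (1 / 2) : R); rewrite expRN => h.
  have e0 := expR_gt0 (1 / 2 : R).
  by rewrite -[leLHS]invrK invf_ple ?posrE ?invr_gt0//; lra.
rewrite [X in expR X](_ : _ = 1 / 2 + 1 / 2 :> R); last by field.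
by rewrite expRD; have e0 := expR_gt0 (1 / 2 : R); nra.
Qed.

Lemma bma_risk_bounds n D W delta : (1 <= n)%N -> 0 <= D -> 0 < delta < 1 / 2 ->
  0 <= W <= expR (2 * ln (1 / delta) - n%:R * D) ->
  ln (1 + W) <= 5 * ln (2 / delta) /\
  (3 + ln (1 + W)) * (W / (1 + W)) * D <= 10 * ln (2 / delta) ^+ 2 / n%:R.
Proof.
move=> n1 D0 /andP[d0 d1] /andP[W0 WD].
have n0 : 0 < n%:R :> R by rewrite ltr0n.
set L := ln (2 / delta); set L' := ln (1 / delta).
have id2 : 2 < 1 / delta by rewrite ltr_pdivlMr//; lra.
have expL : expR L = 2 / delta by rewrite lnK ?posrE ?divr_gt0.
have expL' : expR L' = 1 / delta by rewrite lnK ?posrE ?divr_gt0.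
have LL' : L' <= L by rewrite ler_ln ?posrE ?divr_gt0// ler_pM2r ?invr_gt0//; lra.
have e2L' : expR (2 * L') = (1 / delta) ^+ 2 by rewrite expRM_natl expL'.
have L'2 : 1 <= 2 * L'.
  by rewrite -ler_expR e2L' (le_trans expR1_le4)//; nra.
have L1 : 1 <= L.
  rewrite -ler_expR expL (le_trans expR1_le4)//.
  have -> : 2 / delta = 2 * (1 / delta) by rewrite mulrA mulr1.
  lra.
have nD0 : 0 <= n%:R * D by rewrite mulr_ge0.
have W2 : W <= (1 / delta) ^+ 2.
  by rewrite -e2L' (le_trans WD)// ler_expR gerBl.
(* Indeed [1 + W <= 1 + 1 / delta ^ 2 <= 4 / delta ^ 2]. *)
have lL : ln (1 + W) <= 2 * L.
  rewrite -ler_expR lnK ?posrE; last lra.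
  rewrite expRM_natl expL.
  have -> : (2 / delta) ^+ 2 = 4 * (1 / delta) ^+ 2 by rewrite !exprMn expr1n; ring.
  by move: W2 id2; set y := 1 / delta; nra.
have l0 : 0 <= ln (1 + W) by rewrite ln_ge0// lerDl.
set a := W / (1 + W).
have a0 : 0 <= a by rewrite divr_ge0//; lra.
have a1 : a <= 1 by rewrite ler_pdivrMr; lra.
have aW : a <= W by rewrite ler_pdivrMr; nra.
(* For small [n D] use [a <= 1]; for large [n D] use [a <= W], whose exponential decay beats the
   factor [n D]. *)
have aD : a * (n%:R * D) <= 2 * L'.
  have [zM|Mz] := leP (n%:R * D) (2 * L'); first by rewrite (le_trans _ zM)// ler_piMl.
  rewrite mulrC (le_trans _ (mul_expRB_le L'2 (ltW Mz)))//.
  by rewrite ler_wpM2l// (le_trans aW).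
split; first by lra.
(* The constant 10 comes from [(3 + 2 L) * 2 L = 6 L + 4 L ^ 2] and [L >= 1]. *)
rewrite ler_pdivlMr//.
have -> : (3 + ln (1 + W)) * a * D * n%:R = (3 + ln (1 + W)) * (a * (n%:R * D)) by ring.
apply: (@le_trans _ _ ((3 + 2 * L) * (2 * L))); last by nra.
have h1 : 3 + ln (1 + W) <= 3 + 2 * L by rewrite lerD2l.
have h2 : a * (n%:R * D) <= 2 * L by rewrite (le_trans aD)// ler_pM2l.
by apply: ler_pM => //; [rewrite addr_ge0|rewrite mulr_ge0].
Qed.

End numeric_bounds.

(** * Range and measurability of the averaging weight *)

Section bma_weight.
Context d d' (Omega : measurableType d) (X : measurableType d') (R : realType).
Variables (P : probability Omega R) (n : nat) (Xs : 'I_n -> {RV P >-> X}).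
Variables p q : X -> R.
Hypotheses (mp : measurable_fun setT p) (mq : measurable_fun setT q).
Hypotheses (p0 : forall x, 0 <= p x) (q0 : forall x, 0 <= q x).

Lemma bma_weight_itv (x : 'I_n -> X) : 0 <= bma_weight p q x <= 1.
Proof.
have Pp : 0 <= \prod_i p (x i) by exact: prodr_ge0.
have Q0 : 0 <= \prod_i q (x i) by exact: prodr_ge0.
rewrite /bma_weight divr_ge0 ?addr_ge0//=.
have [->|S0] := eqVneq (\prod_i p (x i) + \prod_i q (x i)) 0; first by rewrite invr0 mulr0.
by rewrite ler_pdivrMr ?lt0r ?S0 ?addr_ge0// mul1r lerDr.
Qed.

Lemma measurable_bma_weight :
  measurable_fun setT (fun w => bma_weight p q (fun i => Xs i w)).
Proof.
have mpX : measurable_fun setT (fun w => \prod_(i < n) p (Xs i w)).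
  by apply: measurable_prod => i _; exact: measurableT_comp.
have mqX : measurable_fun setT (fun w => \prod_(i < n) q (Xs i w)).
  by apply: measurable_prod => i _; exact: measurableT_comp.
apply: measurable_fun_div => //; first exact: measurable_funD.
by move=> w _; rewrite addr_ge0// prodr_ge0.
Qed.

(** The trace of [J] on the unit interval is order-convex, hence an interval and Borel, and the
    weight always lies in the unit interval. *)
Lemma measurable_bma_weight_itv (J : set R) :
  (forall a b c, 0 <= a -> a <= b <= c -> c <= 1 -> J a -> J c -> J b) ->
  measurable [set w | J (bma_weight p q (fun i => Xs i w))].
Proof.
move=> HJ; pose K := J `&` [set a | 0 <= a <= 1].
have mK : measurable K.
  apply: is_interval_measurable => a c [Ja /andP[a0 a1]] [Jc /andP[c0 c1]] b /andP[ab bc].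
  split; last by apply/andP; split; [exact: le_trans ab|exact: le_trans c1].
  by apply: (HJ a b c) => //; rewrite ab.
rewrite [X in measurable X](_ : _ =
    (fun w => bma_weight p q (fun i => Xs i w)) @^-1` K).
  by rewrite -[X in measurable X]setTI; exact: measurable_bma_weight.
by apply/seteqP; split => w /=; [move=> Jw; split => //; exact: bma_weight_itv|case].
Qed.

End bma_weight.

(** * Events of the sample: measurability and probability estimates *)

Section bma_events.
Context d d' (Omega : measurableType d') (X : measurableType d) (R : realType).
Variables (mu : {measure set X -> \bar R}) (p q : X -> R).
Variables (P : probability Omega R) (n : nat) (Xs : 'I_n -> {RV P >-> X}).
Hypotheses (dp : is_density mu p) (dq : is_density mu q).

Let mp : measurable_fun setT p. Proof. by case: dp. Qed.
Let mq : measurable_fun setT q. Proof. by case: dq. Qed.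
Let p0 x : 0 <= p x. Proof. by case: dp. Qed.
Let q0 x : 0 <= q x. Proof. by case: dq. Qed.

(* [P] is only meaningful on measurable sets. As [mu] need not be sigma-finite, measurability of
   the event is drawn from the monotonicity of the divergence in the mixture weight. *)
Lemma measurable_KL_bma_le (y : \bar R) :
  measurable [set w | KL mu p (bma p q (fun i => Xs i w)) <= y]%E.
Proof.
apply: (measurable_bma_weight_itv Xs mp mq p0 q0
  (J := [set a | KL mu p (fun x => (1 - a) * p x + a * q x)%R <= y]%E)).
move=> a b c a0 /andP[ab bc] c1 /= _; apply: le_trans; apply: le_KL_mixture => //.
by rewrite bc (le_trans a0).
Qed.

Lemma measurable_KL_bma_ge (y : \bar R) :
  measurable [set w | y <= KL mu p (bma p q (fun i => Xs i w))]%E.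
Proof.
apply: (measurable_bma_weight_itv Xs mp mq p0 q0
  (J := [set a | y <= KL mu p (fun x => (1 - a) * p x + a * q x)%R]%E)).
move=> a b c a0 /andP[ab bc] c1 /= + _ => /le_trans; apply; apply: le_KL_mixture => //.
- by rewrite a0 ab.
- exact: le_trans c1.
Qed.

(** Passes to the law of [Y], then applies the weighted change of variables along the identity with
    weight [p]. *)
Lemma integral_has_density (Y : {RV P >-> X}) (f : X -> \bar R) :
  has_density mu p Y -> measurable_fun setT f -> (forall x, 0 <= f x)%E ->
  (\int[P]_w f (Y w) = \int[mu]_x (f x * (p x)%:E))%E.
Proof.
move=> Yp mf f0; rewrite -[LHS](ge0_integral_distribution Y)//.
by rewrite -(ge0_integral_weighted_comp mp p0 (@measurable_id _ _ setT)
  (fun A mA => esym (Yp A mA))).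
Qed.

Hypothesis iid : iid_with_density mu p Xs.

(** No [X_i] charges the zero set of [p], and independence multiplies the probabilities 1. On this
    event the likelihood ratio has a nonzero denominator. *)
Lemma likelihood_gt0_as : P [set w | 0 < \prod_i p (Xs i w)] = 1%E.
Proof.
have [ind dX] := iid; have [_ _ p1] := dp.
have mpos : measurable [set x | 0 < p x].
  rewrite (_ : [set x | 0 < p x] = p @^-1` `]0, +oo[); last first.
    by apply/seteqP; split => x /=; rewrite in_itv/= andbT.
  by rewrite -[X in measurable X]setTI; exact: mp.
have := ind [set: 'I_n]%SET (fun=> [set x | 0 < p x]) (fun=> mpos).
rewrite [X in P X](_ : _ = [set w | 0 < \prod_i p (Xs i w)]); last first.
  apply/seteqP; split => w /= H.
    by rewrite prodr_gt0// => i _; apply: H; rewrite finset.in_setT.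
  move=> i _; rewrite lt0r p0 andbT; move: H; rewrite lt0r => /andP[/prodf_neq0 H _].
  exact: H.
move=> ->; rewrite big1// => i _.
have := dX i [set x | 0 < p x] mpos; rewrite /distribution /pushforward => ->.
rewrite -p1 integral_mkcond; apply: eq_integral => x _; rewrite patchE.
case: ifPn => //; rewrite notin_setE /= => /negP; rewrite -leNgt => px.
by congr EFin; apply/eqP; rewrite eq_le px p0.
Qed.

(** Markov's inequality for the square root of the likelihood ratio, whose mean [(1 - D / 2) ^ n] is
    at most [expR (- (n D / 2))]. *)
Lemma likelihood_ratio_tail (D delta : R) :
  0 <= D <= 2 ->
  (\int[mu]_x (Num.sqrt (p x) * Num.sqrt (q x))%:E = (1 - D / 2)%:E)%E ->
  0 < delta ->
  (P [set w | expR (- (n%:R * D / 2)) / delta <=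
              \prod_i Num.sqrt (q (Xs i w) / p (Xs i w))]%R <= delta%:E)%E.
Proof.
move=> /andP[D0 D2] DE d0; have [ind dX] := iid.
pose f x := Num.sqrt (q x / p x).
have mf : measurable_fun setT f by apply: measurable_sqrt; exact: measurable_fun_div.
have f0 x : 0 <= f x by exact: sqrtr_ge0.
have Ef i : (\int[P]_w (f (Xs i w))%:E = (1 - D / 2)%:E)%E.
  rewrite (integral_has_density (dX i) (f := EFin \o f)) -?DE; first last.
  - by move=> x; rewrite lee_fin.
  - exact/measurable_EFinP.
  apply: eq_integral => x _; rewrite /= -EFinM; congr EFin; rewrite /f.
  (* Where [p] vanishes both integrands are 0. *)
  have := p0 x; rewrite le_eqVlt => /predU1P[<-|px]; first by rewrite mulr0 sqrtr0 mul0r.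
  rewrite sqrtrM// sqrtrV ?ltW// -{2}(sqr_sqrtr (ltW px)).
  by field; rewrite gt_eqF// sqrtr_gt0.
have EF := integral_prod_indep ind (fun=> mf) (fun=> f0) Ef.
set t := expR _ / _; have t0 : 0 < t by rewrite divr_gt0// expR_gt0.
have mF : measurable_fun setT (fun w => (\prod_i f (Xs i w))%:E).
  by apply/measurable_EFinP; apply: measurable_prod => i _; exact: measurableT_comp.
have := le_integral_abse P measurableT mF t0.
rewrite setTI.
have F0 w : 0 <= \prod_i f (Xs i w) by exact: prodr_ge0.
under eq_integral do rewrite /= ger0_norm//.
rewrite EF prodr_const card_ord.
under eq_set do rewrite /= lee_fin ger0_norm//.
rewrite -lee_pdivlMl// => /le_trans; apply; rewrite -EFinM lee_fin.
rewrite ler_pdivrMl// /t divfK ?gt_eqF//.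
rewrite (_ : - (n%:R * D / 2) = n%:R * - (D / 2)); last by ring.
(* [D <= 2] keeps the base [1 - D / 2] nonnegative, as raising to the power [n] requires. *)
rewrite expRM_natl lerXn2r ?nnegrE ?expR_ge0//; first lra.
exact: expR_ge1Dx.
Qed.

End bma_events.

(** * The upper bound with high probability *)

Lemma bma_KL_upper d d' (X : measurableType d) (R : realType)
    (mu : {measure set X -> \bar R}) (p q : X -> R) (n : nat)
    (Omega : measurableType d') (P : probability Omega R)
    (Xs : 'I_n -> {RV P >-> X}) (delta : R) :
  is_density mu p -> is_density mu q -> (1 <= n)%N ->
  iid_with_density mu p Xs -> 0 < delta < 1 / 2 ->
  ((1 - delta)%:E <=
    P [set w | KL mu p (bma p q (fun i => Xs i w)) <=
      (Num.min (10 * ln (2 / delta) ^+ 2 / n%:R) (5 * ln (2 / delta)))%:E])%E.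
Proof.
move=> dp dq n1 iid /[dup] delta01 /andP[d0 d1].
have [mp p0 _] := dp; have [mq q0 _] := dq.
have [D [/[dup] D02 /andP[D0 D2] DE BE]] := hellinger_affinity dp dq.
have PA := likelihood_ratio_tail dp dq iid D02 BE d0.
have PB := likelihood_gt0_as dp iid.
move: PA PB; set A := [set w | _ <= _]; set B := [set w | 0 < _] => PA PB.
have mpX : measurable_fun setT (fun w => \prod_i p (Xs i w)).
  by apply: measurable_prod => i _; exact: measurableT_comp.
have mA : measurable A.
  rewrite -[A]setTI; apply: measurable_fun_le => //.
  apply: measurable_prod => i _; apply: (@measurableT_comp _ _ _ _ _ _
    (fun x => Num.sqrt (q x / p x))) => //.
  by apply: measurable_sqrt; exact: measurable_fun_div.
have mB : measurable B.
  rewrite [B](_ : _ = (fun w => \prod_i p (Xs i w)) @^-1` `]0, +oo[); last first.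
    by apply/seteqP; split => w /=; rewrite in_itv/= andbT.
  by rewrite -[X in measurable X]setTI; exact: mpX.
have mAB : measurable (A `|` ~` B) by apply: measurableU => //; exact: measurableC.
(* The good event: the square-root ratio lies below the Markov threshold and the likelihood of [p]
   is positive. The first fails with probability at most [delta], the second with probability 0. *)
apply: (@le_trans _ _ (P (~` (A `|` ~` B)))).
  rewrite probability_setC// EFinB leeB//.
  apply: (le_trans (measureU2 _ mA (measurableC mB))).
  have PB0 : (P (~` B) <= 0)%E by rewrite probability_setC// PB subee.
  by apply: (le_trans (leeD PA PB0)); rewrite adde0.
apply: le_measure; rewrite ?inE.
- exact: measurableC.
- exact: measurable_KL_bma_le.
move=> w; rewrite /A /B setCU setCK => -[/= /negP + Pp0].
rewrite -ltNge; set F := \prod_i _ => Ft.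
set Pp := \prod_i p (Xs i w) in Pp0; set Q := \prod_i q (Xs i w).
have Q0 : 0 <= Q by exact: prodr_ge0.
have FE : F ^+ 2 = Q / Pp.
  rewrite -prodrXl -prodf_div; apply: eq_bigr => i _.
  by rewrite sqr_sqrtr// divr_ge0.
have F0 : 0 <= F by apply: prodr_ge0 => i _; exact: sqrtr_ge0.
set W := Q / Pp; have W0 : 0 <= W by rewrite divr_ge0// ltW.
have W1 : 0 < 1 + W by lra.
have WE : bma_weight p q (fun i => Xs i w) = W / (1 + W).
  rewrite /bma_weight -/Pp -/Q /W; field; rewrite !gt_eqF//= ltr_pwDl//.
have WD : W <= expR (2 * ln (1 / delta) - n%:R * D).
  rewrite (_ : _ - _ = 2 * (ln (1 / delta) + - (n%:R * D / 2))); last by field.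
  rewrite expRM_natl expRD lnK ?posrE ?divr_gt0// /W -FE.
  rewrite mul1r mulrC lerXn2r ?nnegrE ?divr_ge0 ?expR_ge0 ?(ltW d0)//.
  exact: ltW Ft.
have [b1 b2] := bma_risk_bounds n1 D0 delta01 (introT andP (conj W0 WD)).
have a01 := bma_weight_itv p0 q0 (fun i => Xs i w).
(* Here [1 - a = 1 / (1 + W)], so [l = ln (1 + W)] is admissible in both divergence bounds. *)
have ea : expR (- ln (1 + W)) <= 1 - bma_weight p q (fun i => Xs i w).
  rewrite WE expRN lnK ?posrE// le_eqVlt; apply/orP; left; apply/eqP; field.
  by rewrite gt_eqF.
rewrite EFin_min le_min; apply/andP; split.
- apply: le_trans (KL_mixture_le_hellinger dp dq _ ea DE) _.
    by move/andP: a01 => [-> _] /=; rewrite -subr_gt0 (lt_le_trans _ ea)// expR_gt0.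
  by rewrite lee_fin WE.
- by apply: le_trans (KL_mixture_le_ln dp dq a01 ea) _; rewrite lee_fin.
Qed.

(** * The lower bound on two points *)

Lemma bma_KL_lower d' (R : realType) (n : nat) (delta theta : R)
    (Omega : measurableType d') (P : probability Omega R) (Xs : 'I_n -> {RV P >-> bool}) :
  let mu : {measure set bool -> \bar R} := counting in
  let p : bool -> R := bernoulli_pmf theta in
  let q : bool -> R := \1_[set true] in
  (1 <= n)%N -> 0 < delta <= expR (- 2) ->
  0 <= theta <= 1 -> (1 - p false) ^+ n = delta ->
  iid_with_density mu p Xs ->
  (delta%:E <= P [set w |
    (Num.min (ln (1 / delta) ^+ 2 / (4 * n%:R)) (1 / 4 * ln (1 / delta)))%:E <=
      KL mu p (bma p q (fun i => Xs i w))])%E.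
Proof.
move=> mu p q n1 /andP[d0 d2] /[dup] theta01 /andP[t0 t1] pn iid.
have n0 : 0 < n%:R :> R by rewrite ltr0n.
have pfE : p false = 1 - theta by [].
have ptE : p true = theta by [].
have thn : theta ^+ n = delta by rewrite -pn pfE subKr.
have [ind dX] := iid.
have p0 x : 0 <= p x by exact: bernoulli_pmf_ge0.
have mu1 b : mu [set b] = 1%E.
  by rewrite /mu/= /counting asboolT// fset_set1 finmap.cardfs1.
have int1 (f : bool -> R) b : (\int[mu]_(x in [set b]) (f x)%:E = (f b)%:E)%E.
  rewrite (eq_integral (cst (f b)%:E)); last by move=> x /[!inE] ->.
  by rewrite integral_cst//= mu1 mule1.
(* The total mass is read off the law of the first observation, which exists since [n >= 1]. *)
have dp : is_density mu p.
  split => //.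
  have := dX (Ordinal n1) setT measurableT.
  by rewrite /distribution /pushforward preimage_setT probability_setT => <-.
have dq : is_density mu q.
  split => [//|x|]; first by rewrite /q indicE.
  by rewrite /q integral_indic// setIT mu1.
set L := ln (1 / delta).
have LE : delta = expR (- L) by rewrite /L div1r lnV ?posrE// opprK lnK.
have L2 : 2 <= L by move: d2; rewrite LE ler_expR lerN2.
have thE : theta = expR (- (L / n%:R)).
  have e0 := expR_ge0 (- (L / n%:R)).
  apply/eqP; rewrite -(@eqrXn2 _ n)// thn LE -expRM_natl; apply/eqP; congr expR.
  by field; rewrite gt_eqF.
(* On [T] the likelihood of [q] is 1 and that of [p] is [theta ^ n = delta], so the true density
   keeps only the weight [delta / (1 + delta)]. *)
pose T := [set w | forall i, Xs i w = true].
have PT : P T = delta%:E.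
  have := ind [set: 'I_n]%SET (fun=> [set true]) (fun=> I).
  rewrite [X in P X](_ : _ = T); last first.
    by apply/seteqP; split => w /= H i; [|move=> _]; apply: H; rewrite ?finset.in_setT.
  move=> ->; rewrite -thn (eq_bigr (fun=> theta%:E)).
    by rewrite prodEFin prodr_const cardsT card_ord.
  move=> i _; have := dX i [set true] I.
  by rewrite /distribution /pushforward int1.
rewrite -PT; apply: le_measure; rewrite ?inE.
- rewrite [T](_ : _ = \bigcap_(i in setT) (Xs i @^-1` [set true])).
    by apply: fin_bigcap_measurable => // i _; exact: measurable_funPTI.
  by apply/seteqP; split => w /= H i; [move=> _|]; exact: H.
- exact: measurable_KL_bma_ge.
move=> w /= Tw; set a := bma_weight p q (fun i => Xs i w).
have aE : 1 - a = delta / (1 + delta).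
  have pE : \prod_(i < n) p (Xs i w) = delta.
    by rewrite (eq_bigr (fun=> theta)) ?prodr_const ?card_ord// => i _; rewrite Tw.
  have qE : \prod_(i < n) q (Xs i w) = 1.
    by rewrite big1// => i _; rewrite Tw /q indicE mem_set.
  rewrite /a /bma_weight pE qE.
  by field; rewrite gt_eqF//; lra.
have q0 x : 0 <= q x by rewrite /q indicE.
have a01 := bma_weight_itv p0 q0 (fun i => Xs i w).
rewrite KL_gapE//; last first.
  exact: is_density_mixture.
have x0 : 0 < L / n%:R by rewrite divr_gt0//; lra.
have epsE : Num.min (L / n%:R) 1 / 2 <= p false.
  by rewrite pfE thE half_min_le_oneBexpRN// ltW.
have pf0 : 0 < p false by rewrite (lt_le_trans _ epsE)// divr_gt0// lt_min x0 ltr01.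
have [_ m0 _] := is_density_mixture dp dq a01.
set r := bma _ _ _.
have rE : r false = delta / (1 + delta) * p false.
  by rewrite /r /bma -/a aE /q indicE memNset// mulr0 addr0.
have r0 : 0 < r false by rewrite rE mulr_gt0// divr_gt0//; lra.
(* The gap is nonnegative, so the term at 0 alone bounds the divergence from below. *)
apply: (@le_trans _ _ (\int[mu]_(x in [set false]) kl_gap (p x) (r x))%E); last first.
  by apply: ge0_subset_integral => // x _; exact: (kl_gap_ge0 (p0 x) (m0 x)).
rewrite (eq_integral (cst (kl_gap (p false) (r false)))); last by move=> x /[!inE] ->.
rewrite integral_cst//= mu1 mule1 kl_gapE// lee_fin.
have ln_ge : L <= ln (p false / r false).
  rewrite ler_ln ?posrE ?divr_gt0// rE.
  rewrite (_ : p false / _ = (1 + delta) / delta); last first.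
    by field; rewrite !gt_eqF//; lra.
  by rewrite ler_pM2r ?invr_gt0//; lra.
(* The gap at 0 is at least [p false * (L - 1)], and [L >= 2], from [delta <= expR (- 2)], makes
   this at least [p false * L / 2]. The bound [p false >= min (L / n, 1) / 2] then gives the
   constant 1/4. *)
have h1 : p false * L <= p false * ln (p false / r false) by rewrite ler_pM2l.
have h2 : Num.min (L / n%:R) 1 / 2 * (L / 2) <= p false * (L / 2).
  by rewrite ler_pM2r//; lra.
have h3 : p false * 2 <= p false * L by rewrite ler_pM2l.
have -> : L ^+ 2 / (4 * n%:R) = L / n%:R * (L / 4) by field; rewrite gt_eqF.
have -> : Num.min (L / n%:R * (L / 4)) (1 / 4 * L) = Num.min (L / n%:R) 1 * (L / 4).
  by rewrite minr_pMl ?divr_ge0//; [congr Num.min; field|lra].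
rewrite -pfE; lra.
Qed.

Theorem proposition5 (R : realType) :
  (forall (d d' : measure_display) (X : measurableType d)
      (mu : {measure set X -> \bar R}) (pstar q : X -> R) (n : nat)
      (Omega : measurableType d') (P : probability Omega R)
      (Xs : 'I_n -> {RV P >-> X}) (delta : R),
    is_density mu pstar -> is_density mu q -> (1 <= n)%N ->
    iid_with_density mu pstar Xs ->
    0 < delta < 1 / 2 ->
    ((1 - delta)%:E <=
      P [set w | KL mu pstar (bma pstar q (fun i => Xs i w)) <=
        (Num.min (10 * ln (2 / delta) ^+ 2 / n%:R)
                 (5 * ln (2 / delta)))%:E])%E)
  /\
  (forall (d' : measure_display) (n : nat) (delta theta : R)
      (Omega : measurableType d') (P : probability Omega R)
      (Xs : 'I_n -> {RV P >-> bool}),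
    let mu : {measure set bool -> \bar R} := counting in
    let pstar : bool -> R := bernoulli_pmf theta in
    let q : bool -> R := \1_[set true] in
    (1 <= n)%N ->
    0 < delta <= expR (- 2) ->
    0 <= theta <= 1 -> (1 - pstar false) ^+ n = delta ->
    iid_with_density mu pstar Xs ->
    (delta%:E <=
      P [set w |
        (Num.min (ln (1 / delta) ^+ 2 / (4 * n%:R))
                 (1 / 4 * ln (1 / delta)))%:E <=
          KL mu pstar (bma pstar q (fun i => Xs i w))])%E).
Proof.
by split=> *; [exact: bma_KL_upper|exact: bma_KL_lower].
Qed.
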